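(* Let $B\in\mathbb{R}^3$ be constant, i.e. consider the charged-particle dynamics $\ddot x=\dot x\times B+F(x)$ in $\mathbb{R}^3$ with constant magnetic field $B(x)=B$ and $F=-\nabla U$. Let $(x_n,v_n)$ be the numerical solution obtained with stepsize $h>0$ by the method $$x_{n+1}=x_n+h\,v_{n+1/2},\qquad v_{n+1}=v_n+h\,v_{n+1/2}\times B+h\,F(x_{n+1/2}),$$ where $v_{n+1/2}=\frac{v_n+v_{n+1}}2$ and $x_{n+1/2}=\frac{x_n+x_{n+1}}2$. Assume that the numerical solution $(x_n,v_n)$ stays in a compact set that is independent of $h$. Let $N\ge 2$ be an arbitrary integer. Then the energy $E(x,v)=\frac12|v|^2+U(x)$ satisfies $$|E(x_{n+1/2},v_{n+1/2})-E(x_{1/2},v_{1/2})|\le C h^2\qquad\text{for } nh\le h^{-N},$$ where the constant $C$ is independent of $n$ and $h$ as long as $nh\le h^{-N}$.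
   Context: The method is called TSM1; the setting is a normal magnetic field (scaling parameter $\epsilon=1$). The potential $U:\mathbb{R}^3\to\mathbb{R}$ is assumed smooth; $\times$ is the cross product and $|\cdot|$ the Euclidean norm. The initial values $x_0$ and $v_0$ are bounded independently of $h$. *)

(* Defs.v *)
From mathcomp Require Import all_boot all_order all_algebra.
From mathcomp Require Import all_classical all_reals all_analysis.
Set Implicit Arguments.
Unset Strict Implicit.
Unset Printing Implicit Defensive.
Import Order.TTheory GRing.Theory Num.Theory.
Import numFieldNormedType.Exports.
Local Open Scope classical_set_scope.
Local Open Scope ring_scope.

Definition partial (R : realType) (d : nat) (i : 'I_d) (f : 'rV[R]_d -> R) :
    'rV[R]_d -> R :=
  fun x => 'D_(delta_mx 0 i) f x.

(* [:: i; j; k] stands for d_i (d_j (d_k f)). *)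
Definition iter_partial (R : realType) (d : nat) (s : seq 'I_d)
    (f : 'rV[R]_d -> R) : 'rV[R]_d -> R :=
  foldr (fun i g => partial i g) f s.

(* C^oo: 'D_v is a total operator, so the existence of each iterated partial
   derivative is required separately from its continuity. *)
Definition smooth (R : realType) (d : nat) (f : 'rV[R]_d -> R) : Prop :=
  forall s : seq 'I_d,
    continuous (iter_partial s f) /\
    forall (i : 'I_d) (x : 'rV[R]_d),
      derivable (iter_partial s f) x (delta_mx 0 i).

Definition gradient (R : realType) (d : nat) (f : 'rV[R]_d -> R)
    (x : 'rV[R]_d) : 'rV[R]_d :=
  \row_i partial i f x.

(* The library norm on 'rV is the sup norm. *)
Definition enorm (R : realType) (d : nat) (v : 'rV[R]_d) : R :=
  Num.sqrt (\sum_i v 0 i ^+ 2).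

(* With indices mod 3, (a x b)_i = a_(i+1) b_(i+2) - a_(i+2) b_(i+1). *)
Definition cross (R : realType) (a b : 'rV[R]_3) : 'rV[R]_3 :=
  \row_(i < 3) (a 0 (i + 1) * b 0 (i + 2) - a 0 (i + 2) * b 0 (i + 1)).

Definition midpoint (R : realType) (u : nat -> 'rV[R]_3) (n : nat) : 'rV[R]_3 :=
  2^-1 *: (u n + u n.+1).

Definition force (R : realType) (U : 'rV[R]_3 -> R) (x : 'rV[R]_3) : 'rV[R]_3 :=
  - gradient U x.

(* The scheme is implicit: (x, v) is any sequence satisfying it. *)
Definition TSM1 (R : realType) (U : 'rV[R]_3 -> R) (B : 'rV[R]_3) (h : R)
    (x v : nat -> 'rV[R]_3) : Prop :=
  forall n : nat,
    x n.+1 = x n + h *: midpoint v n /\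
    v n.+1 = v n + h *: cross (midpoint v n) B + h *: force U (midpoint x n).

Definition energy (R : realType) (U : 'rV[R]_3 -> R) (x v : 'rV[R]_3) : R :=
  2^-1 * enorm v ^+ 2 + U x.

(* Main.v *)
Require Import Defs.
From mathcomp Require Import all_boot all_order all_algebra.
From mathcomp Require Import all_classical all_reals all_analysis.
From mathcomp Require Import zify ring lra.
Import Order.TTheory GRing.Theory Num.Theory.
Import numFieldNormedType.Exports.
Local Open Scope classical_set_scope.
Local Open Scope ring_scope.
Set Implicit Arguments.
Unset Strict Implicit.
Unset Printing Implicit Defensive.

(** Let q_n and w_n be the midpoints of the positions and of the velocities,
    z = (q, w), and let g = (grad U (q), w) be the gradient of the energy H at
    z. The method is the implicit midpoint rule: the increments of y = (x, v)
    are u_n = h J g_n, where the constant skew matrix J carries the magnetic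
    field. Hence s(k, l) = g_k . u_l = h g_k . J g_l is antisymmetric
    ([poisson_pairingC]), and this is the only geometric input.

    Fix m and weights d_j such that the central difference
    D a = sum_j d_j (a_(c+j) - a_(c-j)) differentiates polynomials of degree at
    most 2m exactly at the centre c ([exact_weights_exist]). Three facts give
    the near conservation of H.
    - Summed over c < L, the values D H telescope to H_L - H_0 up to
      differences of H between nearby indices, which are O(h^2).
    - By the chain rule, D H = g_c . D z + O(h^(2m+1)) ([central_midenergy]).
    - Each increment of z is the mean of two consecutive u, so g_c . D z is a
      combination of the sums s(c, c+i) + s(c, c-i) = s(c, c+i) - s(c-i, c),
      which telescope in c. The boundary terms are O(h^2), because
      s(k, l) = s(k, l) - s(k, k) has one factor h in front and another one in
      the difference ([poisson_O2]).
    So H_L - H_0 = O(h^2) + L O(h^(2m+1)) ([bounded_drift]), and for m = N the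
    condition L h <= h^-N makes the second term O(h^2) when h <= 1. For h > 1
    the energy is bounded on the compact set, which suffices.

    The chain rule has to hold to high order with constants that depend neither
    on the trajectory nor on h. For this, on a window of 2m+1 consecutive
    indices a sequence is compared with a polynomial in the time h (j - m)
    whose coefficients are uniformly bounded, up to O(h^M) ([jet]). Such
    sequences are stable under sums, products and smooth functions
    ([jet_comp]), and summing h times such a sequence gains one order
    ([jet_primitive]). The scheme therefore lifts mere boundedness of the
    trajectory to every order M ([trajectory_has_jets]), and the chain rule says
    that H - g_c . z has no first-order coefficient ([defect_flat]). *)

(** * Bounds uniform in the step size *)

Section UniformBounds.
Variables (R : realType) (T : Type) (h : T -> R).
Hypothesis h01 : forall t, 0 < h t <= 1.

(** The index t ranges over all trajectories, each with its own step h t, so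
    that a constant valid for every t is independent of the step and of the
    initial values. *)
Definition uniO (k : nat) (f : T -> R) : Prop :=
  exists C : R, forall t, `|f t| <= C * h t ^+ k.

Lemma uniO_eq k f g : f =1 g -> uniO k f -> uniO k g.
Proof. by move=> fg [C HC]; exists C => t; rewrite -fg. Qed.

Lemma hX_ge0 k t : 0 <= h t ^+ k.
Proof. by rewrite exprn_ge0 // ltW //; case/andP: (h01 t). Qed.

Lemma uniOW k l f : (l <= k)%N -> uniO k f -> uniO l f.
Proof.
move=> lk [C HC]; exists `|C| => t; apply: (le_trans (HC t)).
apply: (le_trans (ler_wpM2r (hX_ge0 k t) (ler_norm C))).
have /andP[h0 h1] := h01 t.
by apply: ler_wpM2l => //; apply: ler_wiXn2l => //; apply: ltW.
Qed.

Lemma uniO0 k : uniO k (fun _ => 0).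
Proof. by exists 0 => t; rewrite normr0 mul0r. Qed.

Lemma uniO_cst c : uniO 0 (fun _ => c).
Proof. by exists `|c| => t; rewrite expr0 mulr1. Qed.

Lemma uniO_h : uniO 1 h.
Proof.
by exists 1 => t; rewrite expr1 mul1r ger0_norm // ltW //; case/andP: (h01 t).
Qed.

Lemma uniOD k f g : uniO k f -> uniO k g -> uniO k (fun t => f t + g t).
Proof.
move=> [C HC] [D HD]; exists (C + D) => t.
by rewrite mulrDl; apply: le_trans (ler_normD _ _) (lerD _ _).
Qed.

Lemma uniON k f : uniO k f -> uniO k (fun t => - f t).
Proof. by move=> [C HC]; exists C => t; rewrite normrN. Qed.

Lemma uniOB k f g : uniO k f -> uniO k g -> uniO k (fun t => f t - g t).
Proof. by move=> Hf /uniON; apply: uniOD. Qed.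

Lemma uniOM k l f g :
  uniO k f -> uniO l g -> uniO (k + l) (fun t => f t * g t).
Proof.
move=> [C HC] [D HD]; exists (C * D) => t.
by rewrite normrM exprD mulrACA ler_pM.
Qed.

Lemma uniOMl k f g : uniO 0 f -> uniO k g -> uniO k (fun t => f t * g t).
Proof. exact: uniOM. Qed.

Lemma uniOX k n f : uniO k f -> uniO (k * n) (fun t => f t ^+ n).
Proof.
move=> Hf; elim: n => [|n IH].
  by rewrite muln0; apply: uniO_eq (uniO_cst 1) => t; rewrite expr0.
by rewrite mulnS; apply: uniO_eq (uniOM Hf IH) => t; rewrite exprS.
Qed.

Lemma uniO_sum k (I : Type) (r : seq I) (P : pred I) (f : I -> T -> R) :
  (forall i, P i -> uniO k (f i)) ->
  uniO k (fun t => \sum_(i <- r | P i) f i t).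
Proof.
move=> Hf; elim: r => [|i r IH].
  by apply: uniO_eq (uniO0 k) => t; rewrite big_nil.
case: (boolP (P i)) => Pi.
  by apply: uniO_eq (uniOD (Hf i Pi) IH) => t; rewrite big_cons Pi.
by apply: uniO_eq IH => t; rewrite big_cons (negbTE Pi).
Qed.

(** The degree is uniformly bounded too; otherwise bounded coefficients would
    not bound the values. *)
Definition bounded_poly (A : T -> {poly R}) : Prop :=
  (exists s, forall t, (size (A t) <= s)%N) /\
  forall k, uniO 0 (fun t => (A t)`_k).

Lemma bounded_polyD A B : bounded_poly A -> bounded_poly B ->
  bounded_poly (fun t => A t + B t).
Proof.
move=> [[s Hs] HA] [[r Hr] HB]; split=> [|k].
  exists (maxn s r) => t; apply: leq_trans (size_polyD _ _) _.
  by rewrite geq_max !leq_max Hs Hr orbT.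
by apply: uniO_eq (uniOD (HA k) (HB k)) => t; rewrite coefD.
Qed.

Lemma bounded_polyM A B : bounded_poly A -> bounded_poly B ->
  bounded_poly (fun t => A t * B t).
Proof.
move=> [[s Hs] HA] [[r Hr] HB]; split=> [|k].
  exists (s + r)%N => t; apply: leq_trans (size_polyMleq _ _) _.
  by apply: leq_trans (leq_pred _) (leq_add _ _).
apply: (@uniO_eq _ (fun t => \sum_(i < k.+1) (A t)`_i * (B t)`_(k - i))).
  by move=> t; rewrite coefM.
by apply: uniO_sum => i _; apply: uniOMl.
Qed.

Lemma bounded_polyC f : uniO 0 f -> bounded_poly (fun t => (f t)%:P).
Proof.
move=> Hf; split=> [|[|k]]; first by exists 1%N => t; apply: size_polyC_leq1.
  by apply: uniO_eq Hf => t; rewrite coefC.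
by apply: uniO_eq (uniO0 0) => t; rewrite coefC.
Qed.

Lemma bounded_poly_coefs s (c : nat -> T -> R) : (forall k, uniO 0 (c k)) ->
  bounded_poly (fun t => \poly_(k < s) c k t).
Proof.
move=> Hc; split=> [|k]; first by exists s => t; apply: size_poly.
case: (ltnP k s) => ks.
  by apply: uniO_eq (Hc k) => t; rewrite coef_poly ks.
by apply: uniO_eq (uniO0 0) => t; rewrite coef_poly ltnNge ks.
Qed.

Lemma uniO_horner A r : bounded_poly A -> uniO 0 r ->
  uniO 0 (fun t => (A t).[r t]).
Proof.
move=> [[s Hs] HA] Hr.
apply: (@uniO_eq _ (fun t => \sum_(i < s) (A t)`_i * r t ^+ i)).
  by move=> t; rewrite -horner_coef_wide.
by apply: uniO_sum => i _; apply: uniOMl => //; apply: uniOX Hr.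
Qed.

(** Discrete integration: the difference operator with step h is h times a
    small perturbation of the derivative, so the leading term c X^s is matched
    by c X^(s+1)/(s+1), and what this creates in lower degrees is bounded since
    h <= 1 and is removed by induction on the degree. *)
Lemma bounded_poly_primitive A : bounded_poly A ->
  exists2 P, bounded_poly P & forall t,
    (P t)`_0 = 0 /\ forall x, (P t).[x + h t] - (P t).[x] = h t * (A t).[x].
Proof.
move=> [[s Hs] HA]; elim: s A Hs HA => [|s IH] A Hs HA.
  exists (fun=> 0); first exact: bounded_polyC (uniO0 0).
  move=> t; split=> [|x]; first by rewrite coef0.
  have /eqP -> : A t == 0 by rewrite -size_poly_leq0.
  by rewrite !horner0 mulr0 subrr.
pose lead t := (A t)`_s / s.+1%:R.
have leadO : uniO 0 lead by apply: uniOM (HA s) (uniO_cst _).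
pose c i t := (A t)`_i - lead t * ('C(s.+1, i)%:R * h t ^+ (s - i)).
have cO i : uniO 0 (c i).
  apply: uniOB => //; apply: uniOMl => //; apply: uniOMl.
    exact: uniO_cst.
  by apply: (uniOW (leq0n _)); apply: uniOX uniO_h.
have [||P [[r Hr] HP] PE] := IH (fun t => \poly_(i < s) c i t).
- by move=> t; apply: size_poly.
- by case: (bounded_poly_coefs s cO).
exists (fun t => P t + lead t *: 'X^(s.+1)).
  apply: bounded_polyD; first by split=> //; exists r.
  split=> [|k].
    exists s.+2 => t; apply: leq_trans (size_scale_leq _ _) _.
    by rewrite size_polyXn.
  apply: (@uniO_eq _ (fun t => lead t * (k == s.+1)%:R)).
    by move=> t; rewrite coefZ coefXn.
  by apply: uniOMl => //; apply: uniO_cst.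
move=> t; have [P0 PD] := PE t; split=> [|x].
  by rewrite coefD P0 coefZ coefXn /= mulr0 addr0.
rewrite !hornerE opprD addrACA {}PD -mulrBr.
have -> : (A t).[x] = (\poly_(i < s) c i t).[x]
    + lead t * \sum_(i < s.+1) 'C(s.+1, i)%:R * h t ^+ (s - i) * x ^+ i.
  rewrite (horner_coef_wide x (Hs t)) horner_poly [in RHS]big_ord_recr /=.
  rewrite big_ord_recr /= mulrDr addrA mulr_sumr -big_split /=.
  rewrite subnn expr0 mulr1 binSn mulrA; congr (_ + _).
    by apply: eq_bigr => i _; rewrite /c -mulrA; ring.
  by rewrite /lead divfK // pnatr_eq0.
rewrite [in RHS]mulrDr; congr (_ + _); rewrite mulrCA; congr (_ * _).
rewrite (addrC x) exprDn big_ord_recr /= subnn expr0 mul1r binn mulr1n addrK.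
rewrite mulr_sumr; apply: eq_bigr => i _.
rewrite subSn -1?ltnS // exprS -mulr_natl; ring.
Qed.

Lemma bounded_polyN A : bounded_poly A -> bounded_poly (fun t => - A t).
Proof.
move=> [[s Hs] HA]; split=> [|k]; first by exists s => t; rewrite size_polyN.
by apply: uniO_eq (uniON (HA k)) => t; rewrite coefN.
Qed.

Lemma uniO_horner_tail A r k : bounded_poly A -> uniO 1 r ->
  uniO k (fun t => (A t).[r t] - \sum_(i < k) (A t)`_i * r t ^+ i).
Proof.
move=> [[s Hs] HA] Hr.
apply: (@uniO_eq _ (fun t => \sum_(i < s) (A t)`_(k + i) * r t ^+ (k + i))).
  move=> t; have Hw := leq_trans (Hs t) (leq_addl k s).
  by rewrite (horner_coef_wide _ Hw) big_split_ord /= addrAC subrr add0r.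
apply: uniO_sum => i _; apply: (uniOW (leq_addr i k)); apply: uniOMl => //.
by rewrite -{1}[(k + i)%N]mul1n; apply: uniOX Hr.
Qed.

(** * Sequences that are polynomial in time up to a power of the step *)

Section Jets.
Variable m : nat.

Definition node (t : T) (j : nat) : R := h t * (j%:R - m%:R).

(** The value at the centre m of the window is matched exactly, not only up to
    O(h^M): a difference a j - a m then has a polynomial without constant term,
    so that products of two such differences have no first-order term. *)
Definition jet (M : nat) (a : T -> nat -> R) (A : T -> {poly R}) : Prop :=
  [/\ bounded_poly A, forall t, (A t)`_0 = a t m &
      forall j, (j <= m.*2)%N ->
        uniO M (fun t => a t j - (A t).[node t j])].

Lemma jet_eq M a A b B : (forall t j, a t j = b t j) -> A =1 B ->
  jet M a A -> jet M b B.
Proof.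
move=> ab AB; have -> : b = a by do 2![apply/funext=> ?]; rewrite ab.
by have -> : B = A by apply/funext=> ?; rewrite AB.
Qed.

Lemma uniO_node j : uniO 1 (node^~ j).
Proof. by rewrite -[1%N]addn0; apply: uniOM uniO_h (uniO_cst _). Qed.

Lemma node_center t : node t m = 0.
Proof. by rewrite /node subrr mulr0. Qed.

Lemma jet_node M a A j : jet M a A -> uniO 0 (fun t => (A t).[node t j]).
Proof.
by case=> HA _ _; apply: uniO_horner HA (uniOW (leq0n _) (uniO_node j)).
Qed.

Lemma jet_bounded M a A j : jet M a A -> (j <= m.*2)%N ->
  uniO 0 (fun t => a t j).
Proof.
move=> Ha jm; have [_ _ /(_ j jm)/(uniOW (leq0n _)) Hj] := Ha.
by apply: uniO_eq (uniOD Hj (jet_node j Ha)) => t; rewrite subrK.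
Qed.

Lemma jet_cst M c : uniO 0 c -> jet M (fun t _ => c t) (fun t => (c t)%:P).
Proof.
move=> Hc; split=> [|t|j _]; first exact: bounded_polyC.
  by rewrite coefC.
by apply: uniO_eq (uniO0 M) => t; rewrite hornerC subrr.
Qed.

Lemma jetD M a A b B : jet M a A -> jet M b B ->
  jet M (fun t j => a t j + b t j) (fun t => A t + B t).
Proof.
move=> [HA A0 Ha] [HB B0 Hb]; split=> [|t|j jm]; first exact: bounded_polyD.
  by rewrite coefD A0 B0.
apply: uniO_eq (uniOD (Ha j jm) (Hb j jm)) => t.
by rewrite hornerD opprD addrACA.
Qed.

Lemma jetN M a A : jet M a A -> jet M (fun t j => - a t j) (fun t => - A t).
Proof.
move=> [HA A0 Ha]; split=> [|t|j jm]; first exact: bounded_polyN.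
  by rewrite coefN A0.
by apply: uniO_eq (uniON (Ha j jm)) => t; rewrite hornerN opprB opprK addrC.
Qed.

Lemma jetB M a A b B : jet M a A -> jet M b B ->
  jet M (fun t j => a t j - b t j) (fun t => A t - B t).
Proof. by move=> HA HB; apply: jetD HA (jetN HB). Qed.

Lemma jetM M a A b B : jet M a A -> jet M b B ->
  jet M (fun t j => a t j * b t j) (fun t => A t * B t).
Proof.
move=> Ja Jb; have [HA A0 Ha] := Ja; have [HB B0 Hb] := Jb.
split=> [|t|j jm]; first exact: bounded_polyM.
  by rewrite coefM big_ord1 subnn A0 B0.
apply: uniO_eq (uniOD (uniOMl (jet_bounded Ja jm) (Hb j jm))
                      (uniOMl (jet_node j Jb) (Ha j jm))) => t.
by rewrite hornerM; ring.
Qed.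

Lemma jetX M a A n : jet M a A ->
  jet M (fun t j => a t j ^+ n) (fun t => A t ^+ n).
Proof.
move=> Ja; elim: n => [|n IH]; first exact: (jet_cst M (uniO_cst 1)).
by apply: jet_eq (jetM Ja IH) => [t j|t]; rewrite exprS.
Qed.

Lemma jet_sum M (I : Type) (r : seq I) (P : pred I)
    (a : I -> T -> nat -> R) (A : I -> T -> {poly R}) :
  (forall i, P i -> jet M (a i) (A i)) ->
  jet M (fun t j => \sum_(i <- r | P i) a i t j)
        (fun t => \sum_(i <- r | P i) A i t).
Proof.
move=> Ja; elim: r => [|i r IH].
  by apply: jet_eq (jet_cst M (uniO0 0)) => [t j|t]; rewrite big_nil.
case: (boolP (P i)) => Pi.
  by apply: jet_eq (jetD (Ja i Pi) IH) => [t j|t]; rewrite big_cons Pi.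
by apply: jet_eq IH => [t j|t]; rewrite big_cons (negbTE Pi).
Qed.

Lemma jet_perturb M a A b : jet M a A ->
  (forall t, b t m = a t m) ->
  (forall j, (j <= m.*2)%N -> uniO M (fun t => b t j - a t j)) ->
  jet M b A.
Proof.
move=> [HA A0 Ha] bm Hb; split=> // [t|j jm]; first by rewrite bm.
by apply: uniO_eq (uniOD (Hb j jm) (Ha j jm)) => t; rewrite addrA subrK.
Qed.

Lemma center_in_window : (m <= m.*2)%N.
Proof. by rewrite -addnn leq_addr. Qed.

Lemma jet_lip M a A j : jet M.+1 a A -> (j <= m.*2)%N ->
  uniO 1 (fun t => a t j - a t m).
Proof.
move=> [HA A0 Ha] jm.
apply: uniO_eq (uniOD (uniOW _ (Ha j jm))
                      (uniO_horner_tail 1 HA (uniO_node j))) => // t.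
by rewrite big_ord1 expr0 mulr1 A0 addrA subrK.
Qed.

(** Without a first-order coefficient, the increments over the window gain one
    more power of h. *)
Lemma jet_flat M a A j : jet M.+2 a A -> (forall t, (A t)`_1 = 0) ->
  (j <= m.*2)%N -> uniO 2 (fun t => a t j - a t m).
Proof.
move=> [HA A0 Ha] A1 jm.
apply: uniO_eq (uniOD (uniOW _ (Ha j jm))
                      (uniO_horner_tail 2 HA (uniO_node j))) => // t.
rewrite big_ord_recr big_ord1 /= expr0 mulr1 A0 A1 mul0r addr0.
by rewrite addrA subrK.
Qed.

Lemma jet_scale M a A : jet M a A ->
  jet M.+1 (fun t j => h t * a t j) (fun t => (h t)%:P * A t).
Proof.
move=> [HA A0 Ha]; split=> [|t|j jm].
- by apply: bounded_polyM HA; apply: bounded_polyC; apply: uniOW uniO_h.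
- by rewrite coefCM A0.
apply: uniO_eq (uniOM uniO_h (Ha j jm)) => t.
by rewrite hornerM hornerC mulrBr.
Qed.

(** This is where smoothness is gained: one order for each use of the scheme. *)
Lemma jet_primitive M u A a : jet M u A ->
  uniO 0 (fun t => a t m) ->
  (forall t j, a t j.+1 - a t j = h t * u t j) ->
  exists P, jet M.+1 a P.
Proof.
move=> [HA A0 Hu] Ha Da; have [P HP PE] := bounded_poly_primitive HA.
exists (fun t => P t + (a t m)%:P).
have HQ := bounded_polyD HP (bounded_polyC Ha).
pose r t j := a t j - (P t + (a t m)%:P).[node t j].
have rm t : r t m = 0.
  rewrite /r node_center hornerD hornerC horner_coef0.
  by case: (PE t) => -> _; rewrite add0r subrr.
have Dr j : (j <= m.*2)%N -> uniO M.+1 (fun t => r t j - r t 0%N).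
  elim: j => [|j IH] jm; first by apply: uniO_eq (uniO0 _) => t; rewrite subrr.
  apply: uniO_eq (uniOD (uniOM uniO_h (Hu j (ltnW jm))) (IH (ltnW jm))) => t.
  rewrite /r.
  have [_ PD] := PE t.
  rewrite mulrBr -Da -PD.
  have -> : node t j.+1 = node t j + h t by rewrite /node -natr1; ring.
  by rewrite !(hornerD, hornerC); ring.
split=> // [t|j jm].
  by rewrite coefD coefC; case: (PE t) => -> _; rewrite add0r.
apply: uniO_eq (uniOB (Dr j jm) (Dr m center_in_window)) => t.
by rewrite rm /r; ring.
Qed.

Definition central (d : nat -> R) (a : nat -> R) : R :=
  \sum_(j < m) d j * (a (m + j.+1)%N - a (m - j.+1)%N).

(** Only odd powers of the distance to the centre survive in a central
    difference, so this says that the derivative at the centre of any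
    polynomial of degree at most 2m in j is reproduced. *)
Definition exact_weights (d : nat -> R) : Prop :=
  forall i, (i <= m.*2)%N ->
    \sum_(j < m) d j * (j.+1%:R ^+ i - (- j.+1%:R) ^+ i) = (i == 1%N)%:R.

(** The weights annihilate every power of the time up to the degree 2m except
    the first one, which is absent by hypothesis. *)
Lemma jet_central d a A : exact_weights d -> jet m.*2.+1 a A ->
  (forall t, (A t)`_1 = 0) -> uniO m.*2.+1 (fun t => central d (a t)).
Proof.
move=> Hd [HA A0 Ha] A1.
have {}Ha j : (j <= m.*2)%N -> uniO m.*2.+1
    (fun t => a t j - \sum_(i < m.*2.+1) (A t)`_i * node t j ^+ i).
  move=> jm.
  apply: uniO_eq (uniOD (Ha j jm)
                        (uniO_horner_tail m.*2.+1 HA (uniO_node j))) => t.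
  by rewrite addrA subrK.
apply: (@uniO_eq _ (fun t => \sum_(j < m) d j *
   ((a t (m + j.+1)%N - \sum_(i < m.*2.+1) (A t)`_i * node t (m + j.+1)%N ^+ i)
  - (a t (m - j.+1)%N -
       \sum_(i < m.*2.+1) (A t)`_i * node t (m - j.+1)%N ^+ i)))).
  move=> t; rewrite /central.
  transitivity (\sum_(j < m) d j * (a t (m + j.+1)%N - a t (m - j.+1)%N)
    - \sum_(j < m) d j * (\sum_(i < m.*2.+1) (A t)`_i * h t ^+ i *
            (j.+1%:R ^+ i - (- j.+1%:R) ^+ i))).
    rewrite -sumrB; apply: eq_bigr => j _; rewrite -mulrBr; congr (_ * _).
    have -> : \sum_(i < m.*2.+1) (A t)`_i * h t ^+ i *
          (j.+1%:R ^+ i - (- j.+1%:R) ^+ i)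
        = \sum_(i < m.*2.+1) (A t)`_i * node t (m + j.+1)%N ^+ i
        - \sum_(i < m.*2.+1) (A t)`_i * node t (m - j.+1)%N ^+ i.
      rewrite -sumrB; apply: eq_bigr => i _; rewrite /node natrB // natrD.
      have -> : m%:R + j.+1%:R - m%:R = j.+1%:R :> R by ring.
      have -> : m%:R - j.+1%:R - m%:R = - j.+1%:R :> R by ring.
      by rewrite !exprMn; ring.
    by ring.
  rewrite [X in _ - X](_ : _ = 0) ?subr0 //.
  under eq_bigr do rewrite mulr_sumr.
  rewrite exchange_big big1 //= => i _.
  under eq_bigr do rewrite mulrCA.
  rewrite -mulr_sumr Hd; last by rewrite -ltnS.
  by case: (eqVneq (i : nat) 1%N) => [->|_]; rewrite ?A1 ?mul0r ?mulr0.
apply: uniO_sum => j _; apply: uniOMl; first exact: uniO_cst.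
apply: uniOB; apply: Ha; first by rewrite -addnn leq_add2l.
by apply: leq_trans (leq_subr _ _) center_in_window.
Qed.

(** The equations for the odd powers 2k+1 < 2m form a Vandermonde system with
    the distinct nodes (j+1)^2, in the unknowns 2 (j+1) d_j. *)
Lemma exact_weights_exist : exists d, exact_weights d.
Proof.
pose V := Vandermonde m (\row_(j < m) (j.+1%:R ^+ 2 : R)).
have Vu : V \in unitmx.
  rewrite unitmxE unitfE det_Vandermonde.
  apply/prodf_neq0 => i _; apply/prodf_neq0 => j ij; rewrite !mxE subr_eq0.
  by rewrite eqrXn2 ?ler0n // eqr_nat eqSS eq_sym neq_ltn ij.
pose e := invmx V *m \col_(i < m) (i == 0%N :> nat)%:R.
have eE k (km : (k < m)%N) :
    \sum_(j < m) e j 0 * (j.+1%:R ^+ 2) ^+ k = (k == 0%N)%:R.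
  have /matrixP/(_ (Ordinal km) 0) := mulKVmx Vu (\col_(i < m) (i == 0%N :> nat)%:R).
  rewrite !mxE /= => <-; apply: eq_bigr => j _.
  by rewrite -/e !mxE mulrC.
exists (fun j => if insub j is Some i then e i 0 / (2 * j.+1%:R) else 0) => i im.
under eq_bigr do rewrite valK.
have [k [b ik]] : exists k, exists b : bool, i = (b + k.*2)%N.
  by exists i./2, (odd i); rewrite odd_double_half.
have sq x : (- x) ^+ k.*2 = x ^+ k.*2 :> R by rewrite -mul2n !exprM sqrrN.
case: b ik => -> {i} in im *; last first.
  rewrite add0n big1 => [|j _]; first by case: k {im sq} => [|k].
  by rewrite sq subrr mulr0.
rewrite add1n eqSS double_eq0 -eE; last by rewrite -ltn_double.
apply: eq_bigr => j _; have : j.+1%:R != 0 :> R by rewrite pnatr_eq0.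
move: (j.+1%:R : R) => y y0; rewrite 2!(exprS _ k.*2) sq -mul2n exprM.
by field.
Qed.

End Jets.
End UniformBounds.

Lemma uniO_forall (R : realType) (T : Type) (h : T -> R) k
    (I : finType) (f : I -> T -> R) :
  (forall i, uniO h k (f i)) ->
  exists C, forall i t, `|f i t| <= C * h t ^+ k.
Proof.
move=> Hf; have Hn i : uniO h k (fun t => `|f i t|).
  by have [C HC] := Hf i; exists C => t; rewrite normr_id.
have [C HC] := uniO_sum (index_enum _) (fun i (_ : true) => Hn i).
exists C => i t; apply: le_trans (HC t); apply: le_trans (ler_norm _).
by rewrite (bigD1 i) //= lerDl sumr_ge0.
Qed.

Lemma jet_bounded0 (R : realType) (T : Type) (h : T -> R) m (a : T -> nat -> R) :
  (forall j, (j <= m.*2)%N -> uniO h 0 (fun t => a t j)) ->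
  jet h m 0 a (fun t => (a t m)%:P).
Proof.
move=> Ha; have am := Ha m (center_in_window m).
split=> [|t|j jm]; first exact: bounded_polyC.
  by rewrite coefC.
by apply: uniO_eq (uniOB (Ha j jm) am) => t; rewrite hornerC.
Qed.

(** * Taylor expansion of smooth functions *)

Section Taylor.
Variable R : realType.

Definition taylor_poly (phi : nat -> R -> R) (K : nat) (a : R) : {poly R} :=
  \sum_(k < K) (phi k a / k`!%:R) *: ('X - a%:P) ^+ k.

Lemma deriv_taylor_poly phi K a :
  (taylor_poly phi K.+1 a)^`() = taylor_poly (fun k => phi k.+1) K a.
Proof.
rewrite /taylor_poly raddf_sum big_ord_recl /= expr0 derivZ derivC scaler0 add0r.
apply: eq_bigr => k _; rewrite /= /bump /= add1n derivZ deriv_exp derivXsubC mul1r.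
rewrite -[_ ^+ k *+ _]scaler_nat scalerA factS natrM; congr (_ *: _).
by field; rewrite nat1r !pnatr_eq0 -lt0n fact_gt0.
Qed.

Lemma horner_taylor_poly phi K a b :
  (taylor_poly phi K a).[b] = \sum_(k < K) (b - a) ^+ k / k`!%:R * phi k a.
Proof.
rewrite /taylor_poly horner_sum; apply: eq_bigr => k _.
by rewrite !hornerE; ring.
Qed.

Lemma mean_value (f df : R -> R) (a b : R) :
  (forall x : R, is_derive x (1 : R) f (df x)) ->
  exists2 c, Num.min a b <= c <= Num.max a b & f b - f a = df c * (b - a).
Proof.
move=> fdf.
have cf x y : {within `[x, y], continuous f}.
  apply: continuous_subspaceT => z; apply: differentiable_continuous.
  by apply/derivable1_diffP; case: (fdf z).
have [ab|/ltW ba] := leP a b.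
  by have [c] := MVT_segment ab (fun x _ => fdf x) (@cf _ _); rewrite in_itv; exists c.
have [c Hc H] := MVT_segment ba (fun x _ => fdf x) (@cf _ _).
exists c; first by move: Hc; rewrite in_itv.
by rewrite -opprB H; ring.
Qed.

(** The derivative of the remainder of order K+1 is the remainder of order K of
    the derivative, so the mean value theorem gives an induction on K. *)
Lemma taylor_remainder phi K (C rho a b : R) :
  (forall k (x : R), is_derive x (1 : R) (phi k) (phi k.+1 x)) ->
  (forall x, `|x| <= rho -> `|phi K x| <= C) ->
  `|a| <= rho -> `|b| <= rho ->
  `|phi 0%N b - \sum_(k < K) (b - a) ^+ k / k`!%:R * phi k a|
    <= C * `|b - a| ^+ K.
Proof.
move=> Dphi HC Ha Hb; rewrite -horner_taylor_poly.
elim: K phi Dphi HC b Hb => [|K IH] phi Dphi HC b Hb.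
  by rewrite /taylor_poly big_ord0 horner0 subr0 expr0 mulr1 HC.
pose psi x := phi 0%N x - (taylor_poly phi K.+1 a).[x].
have Dpsi (x : R) : is_derive x (1 : R) psi
    (phi 1%N x - (taylor_poly (fun k => phi k.+1) K a).[x]).
  by rewrite -deriv_taylor_poly; apply: is_deriveB.
have psia : psi a = 0.
  rewrite /psi horner_taylor_poly big_ord_recl big1 => [|k _].
    by rewrite subrr expr0 fact0 divr1 mul1r addr0 subrr.
  by rewrite subrr expr0n /= !mul0r.
have [c /andP[c1 c2] Hc] := mean_value a b Dpsi.
rewrite -/(psi b) -[psi b]subr0 -psia {}Hc normrM exprSr mulrA.
have Hcr : `|c| <= rho.
  move: Ha Hb c1 c2; rewrite !ler_norml => /andP[Ha1 Ha2] /andP[Hb1 Hb2].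
  case: (leP a b) => ab c1 c2; lra.
have C0 : 0 <= C by apply: le_trans (normr_ge0 _) (HC a Ha).
apply: ler_wpM2r => //.
apply: le_trans (IH (fun k => phi k.+1) _ HC c Hcr) _ => //.
apply: ler_wpM2l => //; rewrite lerXn2r ?nnegrE //.
have N1 := ler_norm (b - a); have := ler_norm (a - b); rewrite distrC => N2.
by rewrite ler_norml; case: (leP a b) c1 c2 => ab c1 c2; lra.
Qed.
End Taylor.

Section SmoothFunctions.
Variables (R : realType) (d : nat).
Implicit Types (f : 'rV[R]_d -> R) (x : 'rV[R]_d) (i : 'I_d).

Lemma smooth_iter_partial f s : smooth f -> smooth (iter_partial s f).
Proof. by move=> Hf r; rewrite /iter_partial -foldr_cat; apply: Hf. Qed.

(** Expanding along one coordinate at a time involves only iterated partial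
    derivatives, which is the form in which smoothness is given. *)
Definition set_coord x i (b : R) : 'rV[R]_d := x + (b - x 0 i) *: delta_mx 0 i.

Lemma set_coordE x i b l : set_coord x i b 0 l = if l == i then b else x 0 l.
Proof.
rewrite /set_coord !mxE eqxx /=; case: eqP => [->|_].
  by rewrite mulr1 addrC subrK.
by rewrite mulr0 addr0.
Qed.

Lemma is_derive_set_coord f x i b : derivable f (set_coord x i b) (delta_mx 0 i) ->
  is_derive b (1 : R) (fun t => f (set_coord x i t)) (partial i f (set_coord x i b)).
Proof.
move=> Df.
have E : (fun k => k^-1 *: (((fun t => f (set_coord x i t)) \o shift b) (k *: (1 : R)) -
     f (set_coord x i b))) =
   (fun k => k^-1 *: ((f \o shift (set_coord x i b)) (k *: delta_mx 0 i) -
     f (set_coord x i b))).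
  apply/funext => k /=; congr (_ *: (f _ - _)).
  have -> : k *: (1 : R) = k by exact: mulr1.
  rewrite /set_coord; apply/rowP => l; rewrite !mxE.
  move: ((_ == _)%:R) => e; ring.
by split; rewrite /derivable /partial /derive /= E.
Qed.

Definition in_box (rho : R) x := forall l, `|x 0 l| <= rho.

Lemma continuous_box_bounded f rho : continuous f ->
  exists C, forall x, in_box rho x -> `|f x| <= C.
Proof.
move=> cf.
have := compact_bounded (continuous_compact (continuous_subspaceT cf)
  (@rV_compact _ d (fun=> `[- rho, rho]%classic) (fun=> @segment_compact _ _ _))).
move=> [C [_ /(_ (C + 1))]]; rewrite ltrDl ltr01 => /(_ isT) HC.
exists (C + 1) => x Hx; apply: HC; exists x => //= l.
by rewrite in_itv /= -ler_norml.
Qed.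

Lemma partial_taylor f i rho K : smooth f -> exists C, forall x b,
  in_box rho x -> `|b| <= rho ->
  `|f (set_coord x i b) -
    \sum_(k < K) (b - x 0 i) ^+ k / k`!%:R * iter_partial (nseq k i) f x|
  <= C * `|b - x 0 i| ^+ K.
Proof.
move=> Hf; have [C HC] := continuous_box_bounded rho (Hf (nseq K i)).1.
exists C => x b Hx Hb.
have := @taylor_remainder _ (fun k t => iter_partial (nseq k i) f (set_coord x i t))
  K C rho (x 0 i) b _ _ (Hx i) Hb.
have -> : set_coord x i (x 0 i) = x.
  by rewrite /set_coord subrr scale0r addr0.
apply=> [k t|t Ht].
  by apply: is_derive_set_coord; case: (Hf (nseq k i)).
by apply: HC => l; rewrite set_coordE; case: ifP.
Qed.

End SmoothFunctions.

(** * Smooth functions of jets *)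

Section Composition.
Variables (R : realType) (d : nat) (T : Type) (h : T -> R).
Hypothesis h01 : forall t, 0 < h t <= 1.
Variables (m M : nat) (rho : R).
Variables (z : T -> nat -> 'rV[R]_d) (Z : 'I_d -> T -> {poly R}).
Hypothesis jet_z : forall i, jet h m M (fun t j => z t j 0 i) (Z i).
Hypothesis box_z : forall t j, in_box rho (z t j).

(** Moving only the first r coordinates away from the centre interpolates
    between the constant point z t m and the sequence z t. *)
Definition mix (r : nat) (t : T) (j : nat) : 'rV[R]_d :=
  \row_l (if (l < r)%N then z t j 0 l else z t m 0 l).

Lemma mix_set_coord (i : 'I_d) t j :
  mix i.+1 t j = set_coord (mix i t j) i (z t j 0 i).
Proof.
apply/rowP => l; rewrite set_coordE !mxE ltnS leq_eqVlt.
case: (eqVneq l i) => [->|li]; first by rewrite eqxx.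
by rewrite val_eqE (negbTE li).
Qed.

Lemma mix_center r t : mix r t m = z t m.
Proof. by apply/rowP => l; rewrite mxE if_same. Qed.

(** For M = 0 the increments are merely bounded, and from M = 1 on they are
    O(h); in both cases the Taylor remainder of order M+2 is O(h^M). *)
Lemma uniO_increment i j : (j <= m.*2)%N ->
  uniO h M (fun t => (z t j 0 i - z t m 0 i) ^+ M.+2).
Proof.
move=> jm; have Hz := jet_z i.
have O0 : uniO h 0 (fun t => z t j 0 i - z t m 0 i).
  by apply: uniOB; apply: jet_bounded Hz _ => //; apply: center_in_window.
case: M Hz => [|k] Hz; first exact: (uniOX 2 O0).
by apply: (uniOW h01 _ (uniOX k.+3 (jet_lip h01 Hz jm)));
  rewrite mul1n (leq_trans (leqnSn _)).
Qed.

(** Release one more coordinate i and expand in it. The Taylor coefficients are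
    functions of the point with coordinate i still frozen, hence jets by
    induction. In the expansion the terms with k >= 2 have no first-order
    coefficient, and the term with k = 1 contributes the partial derivative at
    the centre times the first-order coefficient of the coordinate i. *)
Lemma jet_comp_mix r (f : 'rV[R]_d -> R) : smooth f -> (r <= d)%N ->
  exists2 F, jet h m M (fun t j => f (mix r t j)) F &
    forall t, (F t)`_1 = \sum_(l < d | (l < r)%N) partial l f (z t m) * (Z l t)`_1.
Proof.
elim: r f => [|r IH] f Hf rd.
  have f0 : uniO h 0 (fun t => f (z t m)).
    have [C HC] := continuous_box_bounded rho (Hf [::]).1.
    by exists C => t; rewrite expr0 mulr1 HC.
  exists (fun t => (f (z t m))%:P) => [|t]; last by rewrite coefC big_pred0.
  apply: jet_eq (jet_cst m M f0) => // t j; congr f.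
  by apply/rowP => l; rewrite mxE.
pose i := Ordinal rd.
have {}IH k := IH (iter_partial (nseq k i) f) (smooth_iter_partial _ Hf) (ltnW rd).
have {IH} [G HG] := choice (fun k => let: ex_intro2 F HF EF := IH k in
  ex_intro (fun F => jet h m M _ F /\ _) F (conj HF EF)).
pose D t := Z i t - (z t m 0 i)%:P.
have zm0 : uniO h 0 (fun t => z t m 0 i).
  by apply: (jet_bounded h01 (jet_z i)); apply: center_in_window.
have JD : jet h m M (fun t j => z t j 0 i - z t m 0 i) D.
  by apply: jetB (jet_z i) (jet_cst m M zm0).
pose a k t j := (z t j 0 i - z t m 0 i) ^+ k / k`!%:R *
  iter_partial (nseq k i) f (mix r t j).
pose A k t := D t ^+ k * (k`!%:R^-1)%:P * G k t.
have JA k : jet h m M (a k) (A k).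
  apply: jetM (HG k).1 => //; apply: jetM => //; first exact: jetX.
  by apply: jet_cst => //; apply: uniO_cst.
exists (fun t => \sum_(k < M.+2) A k t).
  apply: jet_perturb (jet_sum _ _) _ _; first by move=> k _; apply: JA.
    move=> t; rewrite big_ord_recl big1 => [|k _].
      by rewrite /a expr0 fact0 divr1 mul1r addr0 /= !mix_center.
    by rewrite /a subrr expr0n /= !mul0r.
  move=> j jm; have [C HC] := partial_taylor i rho M.+2 Hf.
  have [B HB] := uniO_increment i jm.
  have Bge0 t : 0 <= B * h t ^+ M by apply: le_trans (normr_ge0 _) (HB t).
  exists (`|C| * B) => t; rewrite -mulrA.
  apply: le_trans (_ : C * `|z t j 0 i - z t m 0 i| ^+ M.+2 <= _); last first.
    apply: le_trans (ler_wpM2r _ (ler_norm C)) _; first by rewrite exprn_ge0.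
    by apply: ler_wpM2l => //; rewrite -normrX.
  have := HC (mix r t j) (z t j 0 i).
  rewrite -(mix_set_coord i) /a.
  have -> : mix r t j 0 i = z t m 0 i by rewrite mxE ltnn.
  by apply=> [l|]; rewrite ?mxE; [case: ifP => _|]; apply: box_z.
move=> t; rewrite coef_sum 2!big_ord_recl big1 => [|k _]; last first.
  rewrite /A -mulrA coefM big1 // => l _; rewrite /= /bump !add1n.
  have D0 : (D t)`_0 = 0 by case: JD => _ -> _; rewrite subrr.
  have -> : (D t ^+ k.+2)`_l = 0; last by rewrite mul0r.
  rewrite !exprS; case: l => [[|[|l]] //] /= _.
    by rewrite coefM big_ord1 D0 mul0r.
  rewrite coefM big_ord_recl big_ord1 D0 mul0r add0r /= subnn.
  by rewrite coefM big_ord1 D0 mul0r mulr0.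
rewrite addr0 /A /= !expr0 expr1 fact0 /bump /= invr1 mul1r mul1r.
rewrite mulr1 addn0 (HG 0%N).2 coefM big_ord_recl big_ord1 /= /bump /=.
have [[_ D0 _] [[_ G0 _] _]] := (JD, HG 1%N).
rewrite D0 subrr mul0r add0r subnn G0 /D coefB coefC subr0 mix_center.
rewrite [in RHS](bigD1 i) //= addrC mulrC; congr (_ + _).
by apply: eq_bigl => l; rewrite ltnS -val_eqE /= andbC -ltn_neqAle.
Qed.

Lemma jet_comp f : smooth f ->
  exists2 F, jet h m M (fun t j => f (z t j)) F &
    forall t, (F t)`_1 = \sum_l partial l f (z t m) * (Z l t)`_1.
Proof.
move=> Hf; have [F JF EF] := jet_comp_mix Hf (leqnn d); exists F => [|t].
  apply: jet_eq JF => // t j; congr f.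
  by apply/rowP => l; rewrite mxE ltn_ord.
by rewrite EF; apply: eq_bigl => l; rewrite ltn_ord.
Qed.

End Composition.

(** * Summation of central differences *)

Section Telescoping.
Variable R : realType.

(** Telescoping with lag k leaves k boundary terms at either end. *)
Lemma sum_shift_difference (a : nat -> R) k L :
  \sum_(n < L) (a (n + k)%N - a n) = \sum_(l < k) (a (L + l)%N - a l).
Proof.
elim: L => [|L IH].
  by rewrite big_ord0 big1 // => l _; rewrite add0n subrr.
rewrite big_ord_recr {}IH /= -[LHS]addrC -addrA.
elim: k => [|k IH]; first by rewrite !big_ord0 addn0; ring.
rewrite !big_ord_recr /= -IH !addSn addnS; ring.
Qed.

(** For antisymmetric s this equals s c (c + i) - s (c - i) c, a difference with
    lag i of the sequence k |-> s k (k + i). *)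
Definition paired (s : nat -> nat -> R) (c i : nat) : R :=
  s c (c + i)%N + s c (c - i)%N.

(** The central difference of a sequence whose increments at c are the
    trapezoidal means of s c. *)
Definition quadrature (m : nat) (d : nat -> R) (s : nat -> nat -> R)
    (c : nat) : R :=
  \sum_(j < m) d j * (2^-1 * \sum_(i < j.+1) (paired s c i + paired s c i.+1)).

Lemma central_quadrature m d (P : nat -> R) s :
  (forall l, P l.+1 - P l = 2^-1 * (s m l + s m l.+1)) ->
  central m d P = quadrature m d s m.
Proof.
move=> DP; apply: eq_bigr => j _; congr (_ * _).
have : (j.+1 <= m)%N := ltn_ord j.
elim: (j.+1) => [|i IH] im; first by rewrite big_ord0 addn0 subn0 subrr mulr0.
rewrite big_ord_recr /= mulrDr -(IH (ltnW im)) /paired.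
have := DP (m + i)%N; have := DP (m - i.+1)%N.
rewrite -subSn // subSS !addnS; lra.
Qed.

Lemma quadrature_shift m d s r n :
  (forall k l, r k l = s (n + k)%N (n + l)%N) ->
  quadrature m d r m = quadrature m d s (n + m).
Proof.
move=> rs; apply: eq_bigr => j _; congr (_ * (_ * _)); apply: eq_bigr => i _.
have im : (i.+1 <= m)%N := leq_trans (ltn_ord i) (ltn_ord j).
by rewrite /paired !rs !addnA !addnBA // ltnW.
Qed.

Definition drift_constant (m : nat) (d : nat -> R) : R :=
  \sum_(j < m) `|d j| * (j.+1%:R * (4 + 2 * m%:R)).

(** Sum the last hypothesis over n < L. Both the central differences and the
    antisymmetric quadratures telescope with boundary terms bounded by delta,
    and exactness of the weights on linear functions makes the former add up to
    H L - H 0. *)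
Lemma bounded_drift m d (H : nat -> R) (s : nat -> nat -> R) delta eps L :
  (0 < m)%N -> exact_weights m d ->
  (forall k l, s k l = - s l k) ->
  (forall n k, (k <= m.*2)%N -> `|H (n + k)%N - H n| <= delta) ->
  (forall n k l, (k <= m.*2)%N -> (l <= m.*2)%N ->
     `|s (n + k)%N (n + l)%N| <= delta) ->
  (forall n, `|central m d (fun k => H (n + k)%N) - quadrature m d s (n + m)|
     <= eps) ->
  `|H L - H 0%N| <= drift_constant m d * delta + L%:R * eps.
Proof.
move=> m0 Hd sC HH Hs Heps.
have delta0 : 0 <= delta by apply: le_trans (normr_ge0 _) (HH 0%N 0%N _).
have mm : (m <= m.*2)%N by rewrite -addnn leq_addr.
pose E := \sum_(n < L) central m d (fun k => H (n + k)%N).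
pose Q := \sum_(n < L) quadrature m d s (n + m).
have EQ : `|E - Q| <= L%:R * eps.
  rewrite /E /Q -sumrB; apply: le_trans (ler_norm_sum _ _ _) _.
  rewrite -[L in L%:R]card_ord -sumr_const mulr_suml.
  by apply: ler_sum => n _; rewrite mul1r.
have HE : `|E - (H L - H 0%N)| <= \sum_(j < m) `|d j| * (j.+1%:R * 4 * delta).
  have -> : H L - H 0%N =
      \sum_(j < m) d j * \sum_(l < j.+1.*2) (H L - H 0%N).
    have m1 : (1 <= m.*2)%N by lia.
    have := Hd 1%N m1; rewrite eqxx => Hd1.
    rewrite -[LHS]mul1r -[X in X * _]Hd1 mulr_suml.
    apply: eq_bigr => j _; rewrite -mulrA; congr (_ * _).
    rewrite sumr_const card_ord -[_ *+ _.*2]mulr_natl -[j.+1.*2]muln2 natrM; ring.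
  rewrite /E exchange_big /= -sumrB; apply: le_trans (ler_norm_sum _ _ _) _.
  apply: ler_sum => j _; rewrite -mulr_sumr -mulrBr normrM.
  apply: ler_wpM2l => //.
  have jm : (j.+1 <= m)%N := ltn_ord j.
  pose a n := H (n + (m - j.+1))%N.
  have -> : \sum_(n < L) (H (n + (m + j.+1))%N - H (n + (m - j.+1))%N)
      = \sum_(n < L) (a (n + j.+1.*2)%N - a n).
    by apply: eq_bigr => n _; rewrite /a; congr (H _ - _); lia.
  rewrite sum_shift_difference -sumrB; apply: le_trans (ler_norm_sum _ _ _) _.
  rewrite -mulrA.
  have -> : j.+1%:R * (4 * delta) = \sum_(l < j.+1.*2) (2 * delta).
    by rewrite sumr_const card_ord -[_ *+ _.*2]mulr_natl -[j.+1.*2]muln2 natrM; ring.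
  apply: ler_sum => l _; rewrite /a.
  have window p q : (p < q.+1.*2 -> q.+1 <= m -> p + (m - q.+1) <= m.*2)%N.
    by lia.
  have kb := window _ _ (ltn_ord l) jm.
  have := HH L _ kb; have := HH 0%N _ kb; rewrite !addnA add0n => H0 HL.
  have -> : forall x y z u : R, x - y - (z - u) = (x - z) - (y - u).
    by move=> *; ring.
  by apply: le_trans (ler_normB _ _) _; lra.
have Hpaired i : (i <= m)%N -> `|\sum_(n < L) paired s (n + m) i| <= 2 * m%:R * delta.
  move=> im; pose a n := s (n + (m - i))%N (n + m)%N.
  have -> : \sum_(n < L) paired s (n + m) i = \sum_(n < L) (a (n + i)%N - a n).
    apply: eq_bigr => n _; rewrite /paired /a [s _ (_ - _)%N]sC.
    by congr (s _ _ - s _ _); lia.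
  rewrite sum_shift_difference; apply: le_trans (ler_norm_sum _ _ _) _.
  apply: le_trans (_ : \sum_(l < i) (2 * delta) <= _).
    apply: ler_sum => l _; apply: le_trans (ler_normB _ _) _.
    have i2 : (m - i <= m.*2)%N by lia.
    by have := Hs l _ _ i2 mm; have := Hs (L + l)%N _ _ i2 mm; rewrite /a; lra.
  rewrite sumr_const card_ord -[_ *+ i]mulr_natl mulrA (mulrC i%:R).
  by rewrite !ler_wpM2r // ler_wpM2l // ler_nat.
have HQ : `|Q| <= \sum_(j < m) `|d j| * (j.+1%:R * (2 * m%:R) * delta).
  rewrite /Q exchange_big /=; apply: le_trans (ler_norm_sum _ _ _) _.
  apply: ler_sum => j _; rewrite -!mulr_sumr normrM; apply: ler_wpM2l => //.
  rewrite normrM ger0_norm // exchange_big /=.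
  have : `|\sum_(i < j.+1) \sum_(n < L) (paired s (n + m) i + paired s (n + m) i.+1)|
      <= \sum_(i < j.+1) (2 * m%:R * delta + 2 * m%:R * delta).
    apply: le_trans (ler_norm_sum _ _ _) _; apply: ler_sum => i _.
    have im : (i.+1 <= m)%N by apply: leq_trans (ltn_ord i) (ltn_ord j).
    rewrite big_split /=; apply: le_trans (ler_normD _ _) _.
    by apply: lerD; apply: Hpaired => //; apply: ltnW.
  rewrite sumr_const card_ord -[_ *+ j.+1]mulr_natl => Hsum.
  have -> : j.+1%:R * (2 * m%:R) * delta =
     2^-1 * (j.+1%:R * (2 * m%:R * delta + 2 * m%:R * delta)) by field.
  by apply: ler_wpM2l.
have -> : H L - H 0%N = (E - Q) + Q - (E - (H L - H 0%N)) by ring.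
apply: le_trans (ler_normB _ _) _; apply: le_trans (lerD (ler_normD _ _) (lexx _)) _.
have : drift_constant m d * delta = \sum_(j < m) `|d j| * (j.+1%:R * (2 * m%:R) * delta)
   + \sum_(j < m) `|d j| * (j.+1%:R * 4 * delta).
  rewrite /drift_constant mulr_suml -big_split /=; apply: eq_bigr => j _; ring.
move: EQ HE HQ; lra.
Qed.
End Telescoping.

(** * Antisymmetry of the discrete flow *)

Lemma triple_productC (R : realType) (a b c : 'rV[R]_3) :
  \sum_i a 0 i * cross b c 0 i = - \sum_i b 0 i * cross a c 0 i.
Proof.
have sum3 (f : 'I_3 -> R) : \sum_i f i = f 0 + f 1 + f 2.
  rewrite !big_ord_recr big_ord0 /= add0r.
  by congr (f _ + f _ + f _); apply: val_inj.
have i11 : 1 + 1 = 2 :> 'I_3 by apply: val_inj.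
have i12 : 1 + 2 = 0 :> 'I_3 by apply: val_inj.
have i21 : 2 + 1 = 0 :> 'I_3 by apply: val_inj.
have i22 : 2 + 2 = 1 :> 'I_3 by apply: val_inj.
rewrite !sum3 !mxE !add0r i11 i12 i21 i22; ring.
Qed.

Section Pairings.
Variables (R : realType) (h : R) (q w g a : nat -> 'rV[R]_3).

Definition linear_energy (k j : nat) : R :=
  \sum_i (g k 0 i * q j 0 i + w k 0 i * w j 0 i).

(** With (g, w) the gradient of the energy and h (w, a) the increment of
    (position, velocity), this is the pairing g_k . u_l of the introduction. *)
Definition poisson_pairing (k l : nat) : R :=
  h * \sum_i (g k 0 i * w l 0 i + w k 0 i * a l 0 i).

(** The terms with g cancel by themselves, and the magnetic term is a triple
    product. *)
Lemma poisson_pairingC (B : 'rV[R]_3) k l :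
  (forall n, a n = cross (w n) B - g n) ->
  poisson_pairing k l = - poisson_pairing l k.
Proof.
move=> aE; have {}aE n i : a n 0 i = cross (w n) B 0 i - g n 0 i.
  by rewrite aE !mxE.
rewrite /poisson_pairing -mulrN; congr (_ * _).
transitivity (\sum_i (g k 0 i * w l 0 i - g l 0 i * w k 0 i)
    + \sum_i w k 0 i * cross (w l) B 0 i).
  by rewrite -big_split; apply: eq_bigr => i _; rewrite /= aE; ring.
rewrite triple_productC -sumrN -big_split -sumrN; apply: eq_bigr => i _.
by rewrite /= aE; ring.
Qed.

Lemma poisson_pairing_difference k l :
  poisson_pairing k l - poisson_pairing k k =
  h * \sum_i (g k 0 i * (w l 0 i - w k 0 i) + w k 0 i * (a l 0 i - a k 0 i)).
Proof.
rewrite /poisson_pairing -mulrBr -sumrB; congr (_ * _).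
by apply: eq_bigr => i _; ring.
Qed.

(** The midpoints follow the trapezoidal rule. *)
Lemma linear_energy_increment k l :
  (forall j i, q j.+1 0 i - q j 0 i = 2^-1 * (h * (w j 0 i + w j.+1 0 i))) ->
  (forall j i, w j.+1 0 i - w j 0 i = 2^-1 * (h * (a j 0 i + a j.+1 0 i))) ->
  linear_energy k l.+1 - linear_energy k l =
  2^-1 * (poisson_pairing k l + poisson_pairing k l.+1).
Proof.
move=> Dq Dw; rewrite /linear_energy /poisson_pairing -sumrB -mulrDr -big_split.
rewrite mulrCA !mulr_sumr /=; apply: eq_bigr => i _.
rewrite opprD addrACA -!mulrBr Dq Dw; ring.
Qed.
End Pairings.

(** * Trajectories of the midpoint scheme *)

Section Trajectories.
Variables (R : realType) (U : 'rV[R]_3 -> R) (B : 'rV[R]_3) (rho : R).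
Hypothesis smoothU : smooth U.

(** All trajectories with h <= 1 in a given box. The type is stable under
    shifting the time origin, so estimates on the first window of every
    trajectory hold on all windows. *)
Record trajectory := Trajectory {
  step : R;
  pos : nat -> 'rV[R]_3;
  vel : nat -> 'rV[R]_3;
  step_bounds : 0 < step <= 1;
  scheme : TSM1 U B step pos vel;
  pos_in_box : forall n, in_box rho (pos n);
  vel_in_box : forall n, in_box rho (vel n) }.

Definition midpos (t : trajectory) := midpoint (pos t).
Definition midvel (t : trajectory) := midpoint (vel t).
Definition midgrad (t : trajectory) (n : nat) := gradient U (midpos t n).
Definition accel (t : trajectory) (n : nat) :=
  cross (midvel t n) B - midgrad t n.

Definition shift_trajectory (t : trajectory) (n : nat) : trajectory.
Proof.
refine (@Trajectory (step t) (fun k => pos t (n + k)) (fun k => vel t (n + k))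
  (step_bounds t) _ (fun k => pos_in_box t (n + k)) (fun k => vel_in_box t (n + k))).
by move=> k; rewrite /midpoint !addnS; apply: scheme.
Defined.

Lemma midpos_shift t n k : midpos (shift_trajectory t n) k = midpos t (n + k).
Proof. by rewrite /midpos /midpoint /= addnS. Qed.

Lemma midvel_shift t n k : midvel (shift_trajectory t n) k = midvel t (n + k).
Proof. by rewrite /midvel /midpoint /= addnS. Qed.

Lemma pos_step t j : pos t j.+1 = pos t j + step t *: midvel t j.
Proof. by have [-> _] := scheme t j. Qed.

Lemma vel_step t j : vel t j.+1 = vel t j + step t *: accel t j.
Proof. by have [_ ->] := scheme t j; rewrite scalerDr addrA. Qed.

Lemma midpoint_half_step (u a : nat -> 'rV[R]_3) (h : R) j i :
  u j.+1 = u j + h *: a j ->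
  midpoint u j 0 i = u j 0 i + h * (2^-1 * a j 0 i).
Proof. by move=> E; rewrite /midpoint E !mxE; field. Qed.

Lemma midpoint_increment (u a : nat -> 'rV[R]_3) (h : R) j i :
  (forall k, u k.+1 = u k + h *: a k) ->
  midpoint u j.+1 0 i - midpoint u j 0 i
    = 2^-1 * (h * (a j 0 i + a j.+1 0 i)).
Proof. by move=> Hu; rewrite /midpoint !Hu !mxE; field. Qed.

Lemma midpoint_in_box (u : nat -> 'rV[R]_3) n :
  (forall k, in_box rho (u k)) -> in_box rho (midpoint u n).
Proof.
move=> Hu l; have := Hu n l; have := Hu n.+1 l.
by rewrite /midpoint !mxE !ler_norml => /andP[? ?] /andP[? ?]; lra.
Qed.

Lemma midpos_in_box t n : in_box rho (midpos t n).
Proof. by apply: midpoint_in_box => k; apply: pos_in_box. Qed.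

Lemma midvel_in_box t n : in_box rho (midvel t n).
Proof. by apply: midpoint_in_box => k; apply: vel_in_box. Qed.

Lemma uniO_coord (u : trajectory -> 'rV[R]_3) i :
  (forall t, in_box rho (u t)) -> uniO step 0 (fun t => u t 0 i).
Proof. by move=> Hu; exists rho => t; rewrite expr0 mulr1; apply: Hu. Qed.

Definition has_jet m M (a : trajectory -> nat -> R) := exists A, jet step m M a A.

Let h01 : forall t, 0 < step t <= 1 := step_bounds.

Lemma midgrad_has_jet m M i :
  (forall l, has_jet m M (fun t j => midpos t j 0 l)) ->
  has_jet m M (fun t j => midgrad t j 0 i).
Proof.
move=> /choice [Q HQ].
have [F JF _] := jet_comp h01 HQ (fun t j => midpos_in_box t j)
  (smooth_iter_partial [:: i] smoothU).
by exists F; apply: jet_eq JF => // t j; rewrite mxE.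
Qed.

Lemma accel_has_jet m M i :
  (forall l, has_jet m M (fun t j => midpos t j 0 l)) ->
  (forall l, has_jet m M (fun t j => midvel t j 0 l)) ->
  has_jet m M (fun t j => accel t j 0 i).
Proof.
move=> /(midgrad_has_jet i) [G JG] /choice [W HW].
have Bc l := jet_cst m M (uniO_cst step (B 0 l)).
eexists; apply: jet_eq (jetB (jetB (jetM h01 (HW (i + 1)) (Bc (i + 2)))
  (jetM h01 (HW (i + 2)) (Bc (i + 1)))) JG) => [t j|t]; last by [].
by rewrite !mxE.
Qed.

Lemma midpoint_has_jet m M (u a : trajectory -> nat -> 'rV[R]_3) i :
  (forall t j, u t j.+1 = u t j + step t *: a t j) ->
  (forall t j, in_box rho (u t j)) ->
  has_jet m M (fun t j => a t j 0 i) ->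
  has_jet m M.+1 (fun t j => midpoint (u t) j 0 i).
Proof.
move=> Hu bu [A JA].
have [|t j|P JP] := jet_primitive h01 (a := fun t j => u t j 0 i) JA.
- exact: uniO_coord.
- by rewrite Hu !mxE addrAC subrr add0r.
eexists; apply: jet_eq (jetD JP (jet_scale h01
  (jetM h01 (jet_cst m M (uniO_cst step 2^-1)) JA))) => [t j|t]; last by [].
by rewrite (midpoint_half_step _ (Hu t j)).
Qed.

(** Bootstrap in the order M: a jet for (q, w) gives one for the increments of
    (x, v), whose sum gains an order, and q = x + (h/2) w, w = v + (h/2) a carry
    it back to the midpoints. *)
Lemma trajectory_has_jets m M :
  (forall i, has_jet m M (fun t j => midpos t j 0 i)) /\
  (forall i, has_jet m M (fun t j => midvel t j 0 i)).
Proof.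
elim: M => [|M [IHq IHw]]; split=> i.
- eexists; apply: jet_bounded0 => j _; apply: uniO_coord => t.
  exact: midpos_in_box.
- eexists; apply: jet_bounded0 => j _; apply: uniO_coord => t.
  exact: midvel_in_box.
- by apply: midpoint_has_jet pos_step pos_in_box (IHw i).
- by apply: midpoint_has_jet vel_step vel_in_box (accel_has_jet i IHq IHw).
Qed.

Definition midenergy t j := energy U (midpos t j) (midvel t j).

(** The energy linearised at the point of index k, up to a constant. *)
Definition linear_part t := linear_energy (midpos t) (midvel t) (midgrad t).
Definition poisson t := poisson_pairing (step t) (midvel t) (midgrad t) (accel t).

Lemma poissonC t k l : poisson t k l = - poisson t l k.
Proof. by apply: (@poisson_pairingC _ _ _ _ _ B) => n. Qed.

Lemma linear_part_step t k l :
  linear_part t k l.+1 - linear_part t k l =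
  2^-1 * (poisson t k l + poisson t k l.+1).
Proof.
apply: linear_energy_increment => j i.
  exact: midpoint_increment (pos_step t).
exact: midpoint_increment (vel_step t).
Qed.

Lemma poisson0 t k : poisson t k k = 0.
Proof.
have /eqP := poissonC t k k.
by rewrite -addr_eq0 -mulr2n mulrn_eq0 => /eqP.
Qed.

(** Subtracting s(k, k) = 0 turns the pairing into h times differences over the
    window, which are O(h). *)
Lemma poisson_O2 m k l : (k <= m.*2)%N -> (l <= m.*2)%N ->
  uniO step 2 (fun t => poisson t k l).
Proof.
move=> km lm; have [Jq Jw] := trajectory_has_jets m 1.
have Ja i := accel_has_jet i Jq Jw; have Jf i := midgrad_has_jet i Jq.
have diff (a : trajectory -> nat -> R) :
    has_jet m 1 a -> uniO step 1 (fun t => a t l - a t k).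
  move=> [A JA]; apply: uniO_eq (uniOB (jet_lip h01 JA lm) (jet_lip h01 JA km)).
  by move=> t; ring.
have bnd (a : trajectory -> nat -> R) : has_jet m 1 a -> uniO step 0 (fun t => a t k).
  by move=> [A JA]; apply: jet_bounded JA km.
apply: (@uniO_eq _ _ _ _ (fun t => step t * \sum_i
   (midgrad t k 0 i * (midvel t l 0 i - midvel t k 0 i) +
    midvel t k 0 i * (accel t l 0 i - accel t k 0 i)))).
  move=> t; have := poisson_pairing_difference (step t) (midvel t) (midgrad t)
    (accel t) k l.
  by rewrite -/(poisson t) => <-; rewrite [poisson t k k]poisson0 subr0.
apply: (@uniOM _ _ _ 1 1); first exact: uniO_h h01.
apply: uniO_sum => i _; apply: uniOD; apply: uniOMl.
- exact: bnd (Jf i).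
- exact: diff (Jw i).
- exact: bnd (Jw i).
- exact: diff (Ja i).
Qed.

Lemma midenergyE t j :
  midenergy t j = 2^-1 * (\sum_i midvel t j 0 i ^+ 2) + U (midpos t j).
Proof.
by rewrite /midenergy /energy /enorm sqr_sqrtr // sumr_ge0 // => i _; apply: sqr_ge0.
Qed.

Definition defect m t j := midenergy t j - linear_part t m j.

(** By the chain rule, the energy and its linearisation at the centre have the
    same first-order coefficient. *)
Lemma defect_flat m M : exists2 A, jet step m M (defect m) A & forall t, (A t)`_1 = 0.
Proof.
have [Jq Jw] := trajectory_has_jets m M; have mm := center_in_window m.
have [Q HQ] := choice Jq; have [W HW] := choice Jw.
have [F JF F1] := jet_comp h01 HQ (fun t j => midpos_in_box t j) smoothU.
have fm i : uniO step 0 (fun t => midgrad t m 0 i).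
  by have [G JG] := midgrad_has_jet i Jq; apply: jet_bounded JG mm.
have wm i : uniO step 0 (fun t => midvel t m 0 i) by apply: jet_bounded (HW i) mm.
pose A t := (2^-1)%:P * \sum_i W i t ^+ 2 + F t -
  \sum_i ((midgrad t m 0 i)%:P * Q i t + (midvel t m 0 i)%:P * W i t).
exists A => [|t].
  apply: jet_eq (jetB (jetD (jetM h01 (jet_cst m M (uniO_cst step 2^-1))
    (jet_sum _ (fun i (_ : true) => jetX h01 2 (HW i)))) JF)
    (jet_sum _ (fun i (_ : true) => jetD (jetM h01 (jet_cst m M (fm i)) (HQ i))
                              (jetM h01 (jet_cst m M (wm i)) (HW i))))) => // t j.
  by rewrite /defect midenergyE.
rewrite /A coefB coefD coefCM !coef_sum F1 mulr_sumr -big_split -sumrB big1 //= => i _.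
have [_ W0 _] := HW i.
rewrite expr2 coefM big_ord_recl big_ord1 /= /bump /= addn0 subnn coefD !coefCM W0.
by rewrite subn0 !mxE; field.
Qed.

(** The energy equals its linearisation plus a flat defect, and the increments
    of the linearisation are values of the pairing. *)
Lemma midenergy_O2 m k : (k <= m.*2)%N ->
  uniO step 2 (fun t => midenergy t k - midenergy t 0).
Proof.
move=> km; have [A JA A1] := defect_flat m 2.
have lin j : (j <= m.*2)%N ->
    uniO step 2 (fun t => linear_part t m j - linear_part t m 0).
  elim: j => [|j IH] jm; first by apply: uniO_eq (uniO0 _ _) => t; rewrite subrr.
  have mm := center_in_window m.
  apply: uniO_eq (uniOD (uniOMl (uniO_cst step 2^-1)
     (uniOD (poisson_O2 mm (ltnW jm)) (poisson_O2 mm jm))) (IH (ltnW jm))) => t.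
  by rewrite -linear_part_step addrA subrK.
apply: uniO_eq (uniOD (uniOB (jet_flat h01 JA A1 km) (jet_flat h01 JA A1 (leq0n _)))
  (lin k km)) => t.
by rewrite /defect; ring.
Qed.

Lemma linear_part_central d m t :
  central m d (linear_part t m) = quadrature m d (poisson t) m.
Proof. by apply: central_quadrature => l; apply: linear_part_step. Qed.

Lemma central_midenergy d m : exact_weights m d -> uniO step m.*2.+1
  (fun t => central m d (midenergy t) - quadrature m d (poisson t) m).
Proof.
move=> Hd; have [A JA A1] := defect_flat m m.*2.+1.
apply: uniO_eq (jet_central h01 Hd JA A1) => t.
rewrite -linear_part_central /central -sumrB; apply: eq_bigr => j _.
by rewrite /defect; ring.
Qed.

Lemma energy_bounded : exists C, forall x v : 'rV[R]_3,
  in_box rho x -> in_box rho v -> `|energy U x v| <= C.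
Proof.
have [C HC] := continuous_box_bounded rho (smoothU [::]).1.
exists (2^-1 * \sum_(i < 3) rho ^+ 2 + C) => x v Hx Hv.
apply: le_trans (ler_normD _ _) (lerD _ (HC x Hx)).
rewrite /enorm sqr_sqrtr; last by rewrite sumr_ge0 // => i _; apply: sqr_ge0.
rewrite normrM ger0_norm ?invr_ge0 // ler_wpM2l ?invr_ge0 //.
rewrite ger0_norm; last by rewrite sumr_ge0 // => i _; apply: sqr_ge0.
apply: ler_sum => i _; rewrite -real_normK ?num_real // lerXn2r ?nnegrE //.
by apply: le_trans (Hv i).
Qed.

Lemma midenergy_shift t n k :
  midenergy (shift_trajectory t n) k = midenergy t (n + k).
Proof. by rewrite /midenergy midpos_shift midvel_shift. Qed.

Lemma poisson_shift t n k l :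
  poisson (shift_trajectory t n) k l = poisson t (n + k) (n + l).
Proof.
by rewrite /poisson /poisson_pairing /accel /midgrad !midpos_shift !midvel_shift.
Qed.

Lemma midenergy_long_time m : (0 < m)%N -> exists C D,
  forall t L, `|midenergy t L - midenergy t 0|
    <= C * step t ^+ 2 + L%:R * (D * step t ^+ m.*2.+1).
Proof.
move=> m0; have [d Hd] := exact_weights_exist R m.
have win (i : 'I_m.*2.+1) : (i <= m.*2)%N by rewrite -ltnS.
have [CH HH] := uniO_forall (fun i => midenergy_O2 (win i)).
have [Cs Hs] := uniO_forall (fun p : 'I_m.*2.+1 * 'I_m.*2.+1 =>
  poisson_O2 (win p.1) (win p.2)).
have [D HD] := central_midenergy Hd.
exists (drift_constant m d * Num.max CH Cs), D => t L.
have t2 : 0 <= step t ^+ 2 by apply: sqr_ge0.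
rewrite -mulrA; apply: (bounded_drift (s := poisson t)) m0 Hd _ _ _ _ => //.
- exact: poissonC.
- move=> n k km; have := HH (Ordinal (km : (k < m.*2.+1)%N)) (shift_trajectory t n).
  rewrite !midenergy_shift addn0 /= => /le_trans; apply.
  by apply: ler_wpM2r => //; rewrite le_max lexx.
- move=> n k l km lm.
  have := Hs (Ordinal (km : (k < m.*2.+1)%N), Ordinal (lm : (l < m.*2.+1)%N))
             (shift_trajectory t n).
  rewrite poisson_shift /= => /le_trans; apply.
  by apply: ler_wpM2r => //; rewrite le_max lexx orbT.
move=> n; have HDn := HD (shift_trajectory t n).
rewrite (quadrature_shift _ _ (poisson_shift t n)) in HDn.
have E : midenergy (shift_trajectory t n) = fun k => midenergy t (n + k)%N.
  by apply/funext => k; apply: midenergy_shift.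
by rewrite E in HDn; apply: HDn.
Qed.
End Trajectories.

(** * Conservation of the energy over long times *)

Lemma compact_in_box (R : realType) (d : nat) (K : set ('rV[R]_d * 'rV[R]_d)) :
  compact K -> exists rho, forall x v, K (x, v) -> in_box rho x /\ in_box rho v.
Proof.
move=> /compact_bounded [C [_ /(_ (C + 1))]]; rewrite ltrDl ltr01 => /(_ isT) HC.
have coord (u : 'rV[R]_d) l : `|u 0 l| <= `|u|.
  rewrite [`|u|]mx_normrE.
  exact: (le_bigmax_cond _ (fun ij => `|u ij.1 ij.2|) (j := (0, l))).
exists (C + 1) => x v /HC; rewrite [X in X -> _]/= prod_normE ge_max => /andP[Hx Hv].
by split=> l; apply: le_trans (coord _ _) _.
Qed.

Theorem theorem3p2 (R : realType) (U : 'rV[R]_3 -> R) (B : 'rV[R]_3)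
    (K : set ('rV[R]_3 * 'rV[R]_3)) (N : nat) :
  smooth U -> compact K -> (2 <= N)%N ->
  exists C : R,
    forall (h : R) (x v : nat -> 'rV[R]_3),
      0 < h -> TSM1 U B h x v -> (forall n : nat, K (x n, v n)) ->
      forall n : nat, n%:R * h <= h ^- N ->
        `|energy U (midpoint x n) (midpoint v n)
          - energy U (midpoint x 0) (midpoint v 0)| <= C * h ^+ 2.
Proof.
move=> smoothU /compact_in_box [rho Hrho] N2.
have [E HE] := energy_bounded rho smoothU.
have [|C [D HCD]] := midenergy_long_time B rho smoothU (m := N).
  exact: leq_trans N2.
(* The first bound serves large steps, the second one steps h <= 1. *)
exists (Num.max (E + E) (C + `|D|)) => h x v h0 HT HK n Hn.
have Hx k : in_box rho (x k) by case: (Hrho _ _ (HK k)).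
have Hv k : in_box rho (v k) by case: (Hrho _ _ (HK k)).
have h2 : 0 <= h ^+ 2 by apply: sqr_ge0.
have [h1|/ltW h1] := leP h 1; last first.
  have EB k : `|energy U (midpoint x k) (midpoint v k)| <= E.
    by apply: HE; apply: midpoint_in_box.
  apply: le_trans (ler_normB _ _) _; apply: le_trans (lerD (EB n) (EB 0%N)) _.
  have EE : 0 <= E + E by rewrite addr_ge0 // (le_trans (normr_ge0 _) (EB n)).
  apply: le_trans (ler_wpM2r h2 (_ : E + E <= _)); last by rewrite le_max lexx.
  by rewrite ler_peMr // exprn_ege1.
have h01 : 0 < h <= 1 by rewrite h0 h1.
have := HCD (Trajectory h01 HT Hx Hv) n; rewrite /midenergy /midpos /midvel /=.
move=> /le_trans; apply.
apply: le_trans (ler_wpM2r h2 (_ : C + `|D| <= _)); last by rewrite le_max lexx orbT.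
rewrite mulrDl lerD2l mulrCA.
(* The time bound turns L h^(2N+1) into h^N. *)
have Hn' : n%:R * h ^+ N.*2.+1 <= h ^+ 2.
  rewrite exprS mulrA; apply: le_trans (ler_wpM2r _ Hn) _.
    by rewrite exprn_ge0 // ltW.
  rewrite -addnn exprD mulKf ?expf_neq0 ?gt_eqF //.
  by rewrite ler_wiXn2l // ltW.
apply: le_trans (_ : `|D| * (n%:R * h ^+ N.*2.+1) <= _); last exact: ler_wpM2l.
by rewrite ler_wpM2r ?ler_norm // mulr_ge0 // exprn_ge0 // ltW.
Qed.
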